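(* Let $G$ be a countable group, and let $G \curvearrowright Y$ be a Borel action on a standard Borel space. Suppose there is an uncountable $G$-invariant set $Y_0 \subseteq Y$ such that the action $G \curvearrowright Y_0$ is free. Then for every Borel action $G \curvearrowright X$ on a standard Borel space there is a $G$-invariant Borel set $Z \subseteq Y$ such that $G \curvearrowright Z$ Borel factors onto $G \curvearrowright X$. Moreover, if $X$ has a fixed point (a point $x_0 \in X$ with $g\cdot x_0 = x_0$ for all $g \in G$), then $G \curvearrowright Y$ Borel factors onto $G \curvearrowright X$.
   Context: $G \curvearrowright Y$ Borel factors onto $G \curvearrowright X$ if there is a $G$-equivariant Borel surjection $Y \to X$. The set $Y_0$ is not assumed to be Borel. The action on $Y_0$ is free if $g \cdot y \neq y$ for all $y \in Y_0$ and all $g \in G$ with $g \ne 1_G$. *)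

(* Defs.v *)
From HB Require Import structures.
From mathcomp Require Import all_boot all_order all_algebra.
From mathcomp Require Import all_classical all_reals all_analysis.

Set Implicit Arguments.
Unset Strict Implicit.
Unset Printing Implicit Defensive.

Local Open Scope classical_set_scope.

(* [measurableType] is a [Pointed] structure; this record also allows the
   empty space. *)
Record borelSpace := BorelSpace {
  carrier :> Type ;
  borel : set (set carrier) ;
  borel_sigma_algebra : sigma_algebra [set: carrier] borel }.

Definition borel_map (X Y : borelSpace) (f : X -> Y) : Prop :=
  forall B : set Y, borel B -> borel (f @^-1` B).

(* [completeType] is a [Pointed] structure too, hence the explicit Cauchy
   filter condition. *)
Definition polish (R : realType) (P : metricType R) : Prop :=
  (forall F : set_system P, ProperFilter F -> cauchy F -> exists x : P, F --> x)
  /\ exists2 S : set P, countable S & dense S.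

Definition standard_borel (R : realType) (X : borelSpace) : Prop :=
  exists (P : metricType R) (f : X -> P),
    [/\ polish P, bijective f
      & forall B : set P, <<s open >> B <-> borel (f @^-1` B)].

Section subspace.
Variables (X : borelSpace) (Z : set X).

Definition sub_borel : set (set Z) :=
  [set B | exists2 A : set X, borel A & B = set_val @^-1` A].

Lemma sub_borel_sigma_algebra : sigma_algebra [set: Z] sub_borel.
Proof.
have [b0 bC bU] := borel_sigma_algebra X; split.
- by exists set0 => //; rewrite preimage_set0.
- move=> _ [A bA ->]; exists (~` A); first by rewrite -setTD; exact: bC.
  by rewrite setTD preimage_setC.
- move=> F bF.
  exists (\bigcup_i (sval (cid2 (bF i)))).
    by apply: bU => i; case: cid2.
  by rewrite preimage_bigcup; apply: eq_bigcupr => i _; case: cid2.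
Qed.

Definition subspace_borel : borelSpace := BorelSpace sub_borel_sigma_algebra.

End subspace.

(* As [G] is countable and discrete, it is the same to require that each
   [act g] is Borel or that the map [G * X -> X] is. *)
Record borelAction (G : groupType) (X : borelSpace) := BorelAction {
  act :> G -> X -> X ;
  act1 : forall x : X, act 1%g x = x ;
  actM : forall (g h : G) (x : X), act (g * h)%g x = act g (act h x) ;
  act_borel : forall g : G, borel_map (act g) }.

Section actions.
Variables (G : groupType) (Y : borelSpace) (a : borelAction G Y).

Definition invariant_set (A : set Y) : Prop :=
  forall (g : G) (y : Y), A y -> A (a g y).

Definition free_on (A : set Y) : Prop :=
  forall (g : G) (y : Y), A y -> g <> 1%g -> a g y <> y.

Variables (Z : set Y) (invZ : invariant_set Z).

Definition sub_act (g : G) (z : subspace_borel Z) : subspace_borel Z :=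
  SigSub (mem_set (invZ g (set_valP z))).

Lemma sub_act1 z : sub_act 1%g z = z.
Proof. by apply: val_inj; rewrite /= act1. Qed.

Lemma sub_actM g h z : sub_act (g * h)%g z = sub_act g (sub_act h z).
Proof. by apply: val_inj; rewrite /= actM. Qed.

Lemma sub_act_borel g : borel_map (sub_act g).
Proof. by move=> _ [A bA ->]; exists (a g @^-1` A) => //; exact: act_borel. Qed.

Definition sub_action : borelAction G (subspace_borel Z) :=
  BorelAction sub_act1 sub_actM sub_act_borel.

End actions.

Definition borel_factors_onto (G : groupType) (Y X : borelSpace)
    (a : borelAction G Y) (b : borelAction G X) : Prop :=
  exists f : Y -> X,
    [/\ borel_map f, forall (g : G) (y : Y), f (a g y) = b g (f y)
      & forall x : X, exists y : Y, f y = x].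

(* Main.v *)
Require Import Defs.
From HB Require Import structures.
From mathcomp Require Import all_boot all_order all_algebra.
From mathcomp Require Import all_classical all_reals all_analysis.

(** The idea is to find a Borel set [T] in [Y] that meets each orbit in at
    most one point, lies in the free part of the action, and maps onto [X]
    by a Borel map [f]. The saturation [Z] of [T] is then Borel, every [y]
    in [Z] has exactly one [g] with [g y] in [T], and [y |-> g^-1 f (g y)]
    is an equivariant Borel surjection from [Z] onto [X]; off [Z] it can
    take the value of a fixed point of [X] (lemma
    [extend_from_transversal]).

    The set [T] is a Cantor set (lemma [borel_transversal]). Two obstacles
    stand in the way of the usual construction of a perfect set inside [Y0]:
    the group acts by maps that are only Borel, and [Y0] is not Borel, so
    limits of points of [Y0] may leave it. Both are removed by one device.
    The free part and the sets [g^-1 U], with [U] a basic open set, are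
    countably many Borel sets, and for countably many Borel sets there is a
    closed relation [W] between sequences of integers and points such that
    each point is related to some sequence, and membership of a point in
    each of these sets can be read off one entry of any sequence related to
    it (lemma [witnessed_family], proved by induction on Borel sets in
    [witnessed_borel]). This replaces a change of topology on [Y].

    Choose a sequence [w y] for each [y] in [Y0], and split [Y0] along a
    binary tree into uncountable sets [A t] such that the first entries of
    [w] are constant on [A t] (lemma [fusion_scheme]). Along a branch, both
    the points and their sequences converge; the limits are related by [W]
    because [W] is closed. Hence the limit point lies in each of the
    countably many sets if and only if the sets [A t] far along the branch
    are contained in it. In particular it lies in the free part. The sets [A s] and [A t] at
    the same level can moreover be separated by sets [g^-1 U] and [~` U],
    because two uncountable sets always contain uncountable pieces that are
    separated in this way; limits along different branches then lie in
    different orbits (lemma [perfect_family]).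

    Finally, a point of a Polish space is the limit of a fast converging
    sequence from a countable dense set. The index sequence can be coded in
    a point of the Cantor set, and decoding it gives the Borel surjection
    from [T] onto [X] (lemma [borel_decoding]). *)

Set Implicit Arguments.
Unset Strict Implicit.
Unset Printing Implicit Defensive.

Import Order.TTheory GRing.Theory Num.Theory.
Local Open Scope classical_set_scope.

(** * Borel sets defined by countable formulas *)

Section SigmaAlgebraFormulas.
Variables (T : Type) (M : set (set T)) (sM : sigma_algebra setT M).

Lemma sa_not (Q : T -> Prop) : M [set x | Q x] -> M [set x | ~ Q x].
Proof. by case: sM => _ sC _ /sC; rewrite setTD. Qed.

Lemma sa_const (p : Prop) : M [set _ | p].
Proof.
have [s0 _ _] := sM; have sT : M setT.
  have -> : setT = [set x : T | ~ set0 x] by apply/seteqP; split=> x //= _.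
  exact: sa_not.
have [hp|hp] := pselect p; first
  by rewrite (_ : [set _ | p] = setT) //; apply/seteqP; split.
by rewrite (_ : [set _ | p] = set0) //; apply/seteqP; split.
Qed.

Lemma sa_exists (I : countType) (Q : I -> T -> Prop) :
  (forall i, M [set x | Q i x]) -> M [set x | exists i, Q i x].
Proof.
move=> mQ; have [_ _ sU] := sM.
have -> : [set x | exists i, Q i x] =
    \bigcup_n [set x | if unpickle n is Some i then Q i x else False].
  apply/seteqP; split=> x /=.
    by move=> [i Qi]; exists (pickle i) => //=; rewrite pickleK.
  by move=> [n _] /=; case: unpickle => // i Qi; exists i.
apply: sU => n; case: (unpickle n) => [i|]; first exact: mQ.
exact: (sa_const False).
Qed.

Lemma sa_forall (I : countType) (Q : I -> T -> Prop) :
  (forall i, M [set x | Q i x]) -> M [set x | forall i, Q i x].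
Proof.
move=> mQ; have -> : [set x | forall i, Q i x] = [set x | ~ exists i, ~ Q i x].
  apply/seteqP; split=> x /=; first by move=> h [i]; apply.
  by move=> h i; apply: contrapT => n; apply: h; exists i.
by apply: sa_not; apply: sa_exists => i; exact: sa_not.
Qed.

Lemma sa_and (Q Q' : T -> Prop) :
  M [set x | Q x] -> M [set x | Q' x] -> M [set x | Q x /\ Q' x].
Proof.
move=> mQ mQ'.
have -> : [set x | Q x /\ Q' x] =
    [set x | forall b : bool, (if b then Q else Q') x].
  apply/seteqP; split=> x /=; first by move=> [? ?] [].
  by move=> h; split; [exact: (h true)|exact: (h false)].
by apply: sa_forall => -[].
Qed.

Lemma sa_or (Q Q' : T -> Prop) :
  M [set x | Q x] -> M [set x | Q' x] -> M [set x | Q x \/ Q' x].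
Proof.
move=> mQ mQ'.
have -> : [set x | Q x \/ Q' x] =
    [set x | exists b : bool, (if b then Q else Q') x].
  apply/seteqP; split=> x /=; last by move=> [[] h]; [left|right].
  by move=> [h|h]; [exists true|exists false].
by apply: sa_exists => -[].
Qed.

Lemma sa_impl (Q Q' : T -> Prop) :
  M [set x | Q x] -> M [set x | Q' x] -> M [set x | Q x -> Q' x].
Proof.
move=> mQ mQ'.
have -> : [set x | Q x -> Q' x] = [set x | ~ Q x \/ Q' x].
  apply/seteqP; split=> x /=; last by move=> [nq /nq|].
  by move=> h; have [/h|] := pselect (Q x); [right|left].
by apply: sa_or => //; exact: sa_not.
Qed.

End SigmaAlgebraFormulas.

(** * Naming points of a Polish space by sequences of integers *)

Section Names.
Context {R : realType} {P : metricType R}.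
Local Open Scope ring_scope.

Definition mesh (n : nat) : R := n.+1%:R^-1.

Lemma mesh_gt0 n : 0 < mesh n.
Proof. by rewrite invr_gt0. Qed.

Lemma mesh_le m n : (m <= n)%N -> mesh n <= mesh m.
Proof. by move=> mn; rewrite lef_pV2 ?posrE// ler_nat. Qed.

Lemma mesh_small (e : R) : 0 < e -> exists n, mesh n < e.
Proof.
move=> e0; exists (Num.truncn e^-1).
rewrite /mesh -[ltRHS]invrK ltf_pV2 ?posrE ?invr_gt0//.
exact: truncnS_gt.
Qed.

(** Fast convergence of [d \o a] to [z], at a rate fixed in advance. With a
    fixed rate, an open set that contains the limit is recognised by a
    single term (lemma [name_open]), and having a limit is a countable
    conjunction of conditions on pairs of terms (lemma [name_complete]). *)
Definition name (d : nat -> P) (a : nat -> nat) (z : P) :=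
  forall n, mdist (d (a n)) z <= mesh n.

Definition dense_seq (d : nat -> P) :=
  forall z e, 0 < e -> exists n, mdist (d n) z < e.

Lemma polish_dense_seq : polish P -> P -> exists d, dense_seq d.
Proof.
move=> [_ [S /pfcard_geP cS dS]] p.
case: cS => [S0|[f]].
  have := dS setT (ex_intro _ p I) openT.
  by rewrite S0 setI0 => -[].
exists f => z e e0.
have [] := dS (ball z e)^°.
- by exists z; exact: nbhsx_ballx.
- exact: open_interior.
- move=> y [/interior_subset zy /(@surj _ _ _ _ f)[n _ fn]].
  by exists n; rewrite fn metric_sym; move: zy; rewrite ballEmdist.
Qed.

Definition dense_ball (d : nat -> P) (m : nat * nat) : set P :=
  [set y | mdist (d m.1) y < mesh m.2].

Lemma open_dense_ball d m : open (dense_ball d m).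
Proof.
rewrite openE => y yU; apply/nbhs_ballP.
exists (mesh m.2 - mdist (d m.1) y); first by rewrite /= subr_gt0.
move=> z; rewrite ballEmdist /= ltrBrDl => yz.
by apply: le_lt_trans yz; exact: metric_triangle.
Qed.

Lemma dense_ball_separates d y z : dense_seq d -> y <> z ->
  exists m, dense_ball d m y /\ ~ dense_ball d m z.
Proof.
move=> dd /eqP; rewrite -mdist_gt0 => yz.
have [n ne] := @mesh_small (mdist y z / 2) (divr_gt0 yz (ltr0Sn _ _)).
have [j jy] := dd y _ (mesh_gt0 n).
exists (j, n); split=> // /= jz.
have := metric_triangle y (d j) z; apply/negP; rewrite -ltNge.
by rewrite [ltRHS]splitr metric_sym ltrD// (lt_trans _ ne).
Qed.

Section Naming.
Variables (d : nat -> P).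

Lemma name_unique a z z' : name d a z -> name d a z' -> z = z'.
Proof.
move=> hz hz'; apply: mdist_positivity; apply/eqP; rewrite eq_le mdist_ge0 andbT.
apply/ler_addgt0Pl => e e0; rewrite addr0.
have [n ne] := @mesh_small (e / 2) (divr_gt0 e0 (ltr0Sn _ _)).
apply: le_trans (metric_triangle _ (d (a n)) _) _.
rewrite (splitr e) lerD//; last by apply: le_trans (hz' n) (ltW ne).
by rewrite metric_sym; apply: le_trans (hz n) (ltW ne).
Qed.

Lemma name_exists : dense_seq d -> forall z, exists a, name d a z.
Proof.
move=> dd z; have /choice[a ha] := fun n => dd z (mesh n) (mesh_gt0 n).
by exists a => n; exact: ltW.
Qed.

Lemma name_complete a : polish P ->
  (forall n m, mdist (d (a n)) (d (a m)) <= mesh n + mesh m) ->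
  exists z, name d a z.
Proof.
move=> [cP _] ha.
have [|z] := cP ((d \o a) @ \oo).
  apply: cauchy_exP => e e0.
  have [n ne] := @mesh_small (e / 2) (divr_gt0 e0 (ltr0Sn _ _)).
  exists (d (a n)); exists n => // m /= nm; rewrite ballEmdist /=.
  apply: le_lt_trans (ha n m) _; rewrite (splitr e) ltr_leD//.
  by apply: le_trans (ltW ne); exact: mesh_le.
move=> /cvg_ballP az; exists z => n; apply/ler_addgt0Pr => e e0.
have e20 : 0 < e / 2 by exact: divr_gt0.
have [m me] := mesh_small e20.
have [N _ hN] := az _ e20.
have /= := hN (maxn N m) (leq_maxl _ _); rewrite ballEmdist /= => zN.
apply: le_trans (metric_triangle _ (d (a (maxn N m))) _) _.
rewrite (splitr e) addrA lerD//; last by rewrite metric_sym ltW.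
apply: le_trans (ha _ _) _; rewrite lerD2l; apply: le_trans (ltW me).
exact: mesh_le (leq_maxr _ _).
Qed.

Lemma name_open a z U : name d a z -> open U ->
  U z <-> exists n, forall y, mdist (d (a n)) y <= mesh n -> U y.
Proof.
move=> az oU; split=> [Uz|[n]]; last exact.
have /nbhs_ballP[e /= e0 eU] : nbhs z U by exact: open_nbhs_nbhs.
have [n ne] := @mesh_small (e / 2) (divr_gt0 e0 (ltr0Sn _ _)).
exists n => y yn; apply: eU; rewrite ballEmdist /=.
apply: le_lt_trans (metric_triangle _ (d (a n)) _) _.
rewrite (splitr e) ler_ltD//; last exact: le_lt_trans ne.
by rewrite metric_sym; apply: le_trans (ltW ne); exact: az.
Qed.

End Naming.
End Names.

(** * Reading membership in Borel sets off closed witnesses *)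

Section ClosedWitnesses.
Context {R : realType} {P : metricType R}.
Local Open Scope ring_scope.

Implicit Types (W : (nat -> nat) -> set P) (al : nat -> nat).

(** Closedness of [W] as a subset of the product of the Baire space and [P]. *)
Definition closed_rel W := forall al y,
  (forall n e, 0 < e -> exists al' y',
    [/\ forall k, (k < n)%N -> al' k = al k, mdist y y' < e & W al' y']) ->
  W al y.

Lemma closed_rel_forall I (W : I -> (nat -> nat) -> set P) :
  (forall i, closed_rel (W i)) -> closed_rel (fun al y => forall i, W i al y).
Proof.
move=> cW al y h i; apply: cW => n e e0.
by have [al' [y' [? ? Wy]]] := h n e e0; exists al', y'.
Qed.

Lemma closed_rel_and W W' : closed_rel W -> closed_rel W' ->
  closed_rel (fun al y => W al y /\ W' al y).
Proof.
by move=> cW cW' al y h; split; [apply: cW|apply: cW'] => n e e0;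
  have [al' [y' [? ? []]]] := h n e e0; exists al', y'.
Qed.

Lemma closed_rel_coords j k (Q : nat -> nat -> Prop) :
  closed_rel (fun al _ => Q (al j) (al k)).
Proof.
move=> al y h; have [al' [_ [eal _]]] := h (maxn j k).+1 1 ltr01.
by rewrite !eal// ltnS ?leq_maxl ?leq_maxr.
Qed.

Lemma closed_rel_reindex (s : nat -> nat) W :
  closed_rel W -> closed_rel (fun al => W (al \o s)).
Proof.
move=> cW al y h; apply: cW => n e e0.
have [al' [y' [eal ? ?]]] := h (\max_(k < n) (s k).+1)%N e e0.
exists (al' \o s), y'; split=> // k kn; apply: eal.
exact: (leq_bigmax (Ordinal kn)).
Qed.

Definition read_off (D : set P) W (d : set nat) (k : nat) :=
  forall al y, W al y -> (D y <-> d (al k)).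

(** If [P] is Polish, then so is the closed subspace [W] of the product of the
    Baire space and [P], and its projection is a continuous surjection onto [P]
    that pulls [D] back to a clopen set. *)
Definition witnessed (D : set P) := exists W d k,
  [/\ closed_rel W, forall y, exists al, W al y & read_off D W d k].

(** One sequence stores a witness for each [D i]: the sequence is cut into
    countably many disjoint subsequences, and each is used for one index. *)
Lemma witnessed_family (I : countType) (D : I -> set P) :
  (forall i, witnessed (D i)) -> exists W (d : I -> set nat) (k : I -> nat),
  [/\ closed_rel W, forall y, exists al, W al y &
      forall i, read_off (D i) W (d i) (k i)].
Proof.
move=> /choice[W /choice[d /choice[k WP]]].
exists (fun al y => forall i, W i (al \o (fun m => pickle (i, m))) y), d,
  (fun i => pickle (i, k i)); split.
- by apply: closed_rel_forall => i; apply: closed_rel_reindex; case: (WP i).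
- move=> y.
  have /choice[al alW] i : exists al, W i al y by case: (WP i).
  exists (fun n => if unpickle n is Some (i, m) then al i m else 0%N) => i.
  rewrite (_ : _ \o _ = al i)//.
  by apply/funext => m /=; rewrite pickleK.
- by move=> i al y /(_ i); case: (WP i) => _ _ /[apply].
Qed.

(** The witness for [y] in [U] is a lower bound for the distance from [y] to
    the complement of [U], which is a closed condition on [y], unlike [U y]. *)
Lemma witnessed_open U : open U -> witnessed U.
Proof.
move=> oU.
pose Wsucc n : set P := [set y | forall z, ~ U z -> mesh n <= mdist y z :> R].
exists (fun al y => if al 0%N is n.+1 then Wsucc n y else ~ U y),
  [set k | 0 < k]%N, 0%N; split.
- move=> al y h; case al0: (al 0%N) => [|n].
    move=> Uy; have /nbhs_ballP[e /= e0 eU] : nbhs y U by exact: open_nbhs_nbhs.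
    have [al' [y' [eal yy']]] := h 1%N e e0; rewrite eal// al0; apply.
    by apply: eU; rewrite ballEmdist.
  move=> z Uz; apply/ler_addgt0Pr => e e0.
  have [al' [y' [eal yy']]] := h 1%N e e0; rewrite eal// al0 => /(_ z Uz) nz.
  apply: le_trans nz _; apply: le_trans (metric_triangle _ y _) _.
  by rewrite addrC lerD2l metric_sym ltW.
- move=> y; have [Uy|Uy] := pselect (U y); last by exists (fun=> 0%N).
  have /nbhs_ballP[e /= e0 eU] : nbhs y U by exact: open_nbhs_nbhs.
  have [n ne] := mesh_small e0; exists (fun=> n.+1) => z Uz /=.
  rewrite leNgt; apply/negP => yz; apply: Uz; apply: eU.
  by rewrite ballEmdist /=; exact: lt_trans ne.
- move=> al y /=; case: (al 0%N) => [//|n] /= Wy; split=> // _.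
  apply: contrapT => /Wy; rewrite mdistxx; apply/negP.
  by rewrite -ltNge mesh_gt0.
Qed.

Lemma witnessedC D : witnessed D -> witnessed (~` D).
Proof.
move=> [W [d [k [cW tW Wd]]]]; exists W, (~` d), k; split=> // al y /Wd Dd.
by split=> /= + /Dd.
Qed.

(** A common witness for all the [D j] decides each of them, but the union
    only by an infinite search. The new entry at index 0 records the result
    of the search: [j.+1] if [y] is found in [D j], and 0 if it is in none of
    these sets. *)
Lemma witnessed_bigcup (D : nat -> set P) :
  (forall j, witnessed (D j)) -> witnessed (\bigcup_j D j).
Proof.
move=> /witnessed_family[W [d [k [cW tW Wd]]]].
pose Q j u v := (u = j.+1 -> d j v) /\ (u = 0%N -> ~ d j v).
exists (fun al y => W (al \o succn) y /\ forall j, Q j (al 0%N) (al (k j).+1)),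
  [set u | 0 < u]%N, 0%N; split.
- apply: closed_rel_and; first exact: closed_rel_reindex.
  by apply: closed_rel_forall => j; exact: (@closed_rel_coords 0 (k j).+1 (Q j)).
- move=> y; have [al Wy] := tW y.
  have [[j _ Dj]|nD] := pselect ((\bigcup_j D j) y).
    exists (fun n => if n is m.+1 then al m else j.+1); split=> // i.
    by split=> //= -[<-]; exact: (Wd _ _ _ Wy).1.
  exists (fun n => if n is m.+1 then al m else 0%N); split=> // i.
  by split=> //= _ di; apply: nD; exists i => //; exact: (Wd _ _ _ Wy).2.
- move=> al y /= [Wy Qy]; split.
    move=> [j _ /(Wd _ _ _ Wy) dj]; rewrite lt0n; apply/eqP => al0.
    exact: (Qy j).2 al0 dj.
  case al0 : (al 0%N) => [//|j] _; exists j => //; apply/(Wd _ _ _ Wy).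
  exact: (Qy j).1 al0.
Qed.

Lemma witnessed_borel D : <<s open >> D -> witnessed D.
Proof.
move: D; apply: smallest_sub; last exact: witnessed_open.
split; first by apply: witnessed_open; exact: open0.
- by move=> D wD; rewrite setTD; exact: witnessedC.
- exact: witnessed_bigcup.
Qed.

End ClosedWitnesses.

(** * Splitting an uncountable set along a binary tree *)

Section Fusion.
Context {P : Type} {V M : countType}.
Variables (S : set P) (w : P -> nat -> V) (h : nat -> P -> P) (U : M -> set P).
Hypothesis S_unc : ~ countable S.
Hypothesis sepU : forall y z, y <> z -> exists m, U m y /\ ~ U m z.

Implicit Types (A B : seq bool -> set P) (s t : seq bool).

Definition large A := forall t, ~ countable (A t).
Definition refines A B := forall t, A t `<=` B t.

(** Density and heredity allow finitely many requirements to be met one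
    after the other, as later refinements do not spoil the earlier ones. *)
Definition dense_requirement (Q : (seq bool -> set P) -> Prop) :=
  (forall A, large A -> exists B, [/\ large B, refines B A & Q B]) /\
  (forall A B, refines B A -> Q A -> Q B).

Lemma uncountable_piece (I : countType) (X : set P) (C : I -> set P) :
  ~ countable X -> X `<=` \bigcup_i C i -> exists i, ~ countable (X `&` C i).
Proof.
move=> Xunc XC; apply: contrapT => h0; apply: Xunc.
rewrite (_ : X = \bigcup_i (X `&` C i)).
  apply: bigcup_countable => // i _; apply: contrapT => nc.
  by apply: h0; exists i.
rewrite -setI_bigcupr; apply/seteqP; split=> y Xy; last by case: Xy.
by split=> //; exact: XC.
Qed.

Lemma uncountable_avoid (I : countType) (X : set P) (C : I -> set P) :
  ~ countable X -> (forall i, countable (C i)) ->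
  exists2 y, X y & forall i, ~ C i y.
Proof.
move=> Xunc cC; apply: contrapT => h0; apply: Xunc.
apply: (@sub_countable _ _ _ (\bigcup_i C i)); last exact: bigcup_countable.
apply: subset_card_le => y Xy; apply: contrapT => nC; apply: h0.
by exists y => // i Ci; apply: nC; exists i.
Qed.

Lemma refine_all (I : finType) (Q : I -> (seq bool -> set P) -> Prop) :
  (forall i, dense_requirement (Q i)) ->
  dense_requirement (fun A => forall i, Q i A).
Proof.
move=> dQ; split; last first.
  by move=> A B BA QA i; exact: (dQ i).2 BA (QA i).
move=> A lA.
suff [B [lB BA QB]] : exists B,
    [/\ large B, refines B A & forall i, i \in enum I -> Q i B].
  by exists B; split=> // i; apply: QB; rewrite mem_enum.
elim: (enum I) => [|i l [B [lB BA QB]]]; first by exists A; split=> // t.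
have [B' [lB' BB' QB']] := (dQ i).1 B lB.
exists B'; split=> // [t|j]; first by apply: subset_trans (BA t).
by rewrite inE => /orP[/eqP->//|/QB]; exact: (dQ j).2.
Qed.

Definition constant_on n t A := forall y z, A t y -> A t z -> w y n = w z n.

Definition separated s t i A := s <> t ->
  exists m, A s `<=` h i @^-1` U m /\ A t `<=` ~` U m.

Lemma dense_constant_on n t : dense_requirement (constant_on n t).
Proof.
split=> [A lA|A B BA cA y z /BA Ay /BA]; last exact: cA.
have [v vA] : exists v, ~ countable (A t `&` [set y | w y n = v]).
  by apply: uncountable_piece => // y _; exists (w y n).
exists (fun u => if u == t then A t `&` [set y | w y n = v] else A u); split.
- by move=> u; case: eqP.
- by move=> u; case: eqP => [->|_]; [exact: subIsetl|exact: subset_refl].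
- by move=> y z /=; rewrite eqxx /= => -[_ ->] [_ ->].
Qed.

(** Suppose that no [U m] separates uncountable pieces of [A s] and [A t] in
    the required way. Then a point [a] of [A s] outside the countable pieces
    of [A s] sees only countable sets [A t `\` U m] for the [m] with [h i a]
    in [U m]. Their union covers [A t] up to the point [h i a], so [A t]
    would be countable. *)
Lemma dense_separated s t i : dense_requirement (separated s t i).
Proof.
split=> [A lA|A B BA sA st]; last first.
  have [m [sm tm]] := sA st.
  by exists m; split; apply: subset_trans (BA _) _.
have [<-|/eqP st] := eqVneq s t; first by exists A; split=> // u.
have [m [sm tm]] : exists m, ~ countable (A s `&` h i @^-1` U m) /\
    ~ countable (A t `&` ~` U m).
  apply: contrapT => nosep.
  pose small X : set P := if pselect (countable X) then X else set0.
  have csmall X : countable (small X) by rewrite /small; case: pselect.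
  have [a Aa na] := uncountable_avoid (lA s)
    (fun m => csmall (A s `&` h i @^-1` U m)).
  pose bad (om : option M) : set P :=
    if om is Some m then small (A t `&` ~` U m) else [set h i a].
  have cbad om : countable (bad om).
    by case: om => [m|]; [exact: csmall|exact: countable1].
  have [b Ab nb] := uncountable_avoid (lA t) cbad.
  have [m [Uha Ub]] := sepU (fun e : h i a = b => nb None (esym e)).
  apply: nosep; exists m; split=> cX.
    by apply: (na m); rewrite /small; case: pselect.
  by apply: (nb (Some m)); rewrite /bad /small; case: pselect.
exists (fun u => if u == s then A s `&` h i @^-1` U m else
  if u == t then A t `&` ~` U m else A u); split.
- by move=> u; case: eqP => // _; case: eqP.
- move=> u; case: eqP => [->|_]; first exact: subIsetl.
  by case: eqP => [->|_]; first exact: subIsetl.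
- move=> _; exists m; rewrite eqxx; split; first exact: subIsetr.
  by case: eqP => [e|_]; [case: st|rewrite eqxx; exact: subIsetr].
Qed.

Definition level n A :=
  (forall t, size t = n -> constant_on n t A) /\
  (forall s t i, size s = n -> size t = n -> (i <= n)%N -> separated s t i A).

Lemma dense_level n : dense_requirement (level n).
Proof.
pose Q (i : n.-tuple bool + n.-tuple bool * n.-tuple bool * 'I_n.+1) :=
  match i with
  | inl t => constant_on n t
  | inr (s, t, i) => separated s t i
  end.
have [dQ hQ] : dense_requirement (fun A => forall i, Q i A).
  by apply: refine_all => -[t|[[s t] i]];
    [exact: dense_constant_on|exact: dense_separated].
have QE A : (forall i, Q i A) <-> level n A.
  split=> [QA|[cA sA] [t|[[s t] i]]].
  - split=> [t tn|s t i sn tn ni].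
      by rewrite -[t]/(tval (Tuple (introT eqP tn))); exact: (QA (inl _)).
    have ni' : (i < n.+1)%N by [].
    exact: (QA (inr (Tuple (introT eqP sn), Tuple (introT eqP tn),
      Ordinal ni'))).
  - by apply: cA; rewrite size_tuple.
  - by apply: sA; rewrite ?size_tuple// -ltnS.
split=> [A /dQ[B [? ? /QE]]|A B BA /QE/(hQ _ _ BA)/QE//].
by exists B.
Qed.

(** Nodes are stored with the last choice first, so that the parent of [b :: t]
    is its tail. *)
Lemma fusion_scheme : exists A, [/\
  forall t, A t `<=` S /\ A t !=set0,
  forall b t, A (b :: t) `<=` A t,
  forall t, constant_on (size t) t A &
  forall s t i, size s = size t -> (i <= size s)%N -> separated s t i A].
Proof.
(* A family indexed by all nodes is refined at every step: the children of a
   node start from the set of their parent, and only finitely many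
   requirements are met, those at the current level. *)
have step n (A : {A | large A}) : exists B : {B | large B},
    level n (sval B) /\ forall t, sval B t `<=` sval A (behead t).
  have [B [lB BA nB]] :=
    (dense_level n).1 _ (fun t => svalP A (behead t)).
  by exists (exist _ B lB).
have [f fP] := choice (fun nA => step nA.1 nA.2).
pose A0 : {A | large A} := exist large (fun=> S) (fun=> S_unc).
pose F := fix F n : {A | large A} :=
  if n is m.+1 then f (m.+1, F m) else f (0%N, A0).
have F_level n : level n (sval (F n)).
  by case: n => [|n]; [exact: (fP (0%N, A0)).1|exact: (fP (n.+1, F n)).1].
have F_sub n t : sval (F n.+1) t `<=` sval (F n) (behead t).
  exact: (fP (n.+1, F n)).2.
exists (fun t => sval (F (size t)) t); split.
- move=> t; split.
    elim: t => [|b t IH]; first exact: (fP (0%N, A0)).2.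
    by apply: subset_trans IH; exact: F_sub.
  apply/set0P/eqP => At0; apply: (svalP (F (size t)) t).
  by rewrite At0.
- by move=> b t; exact: F_sub.
- by move=> t; exact: (F_level _).1.
- by move=> s t i st si ne; rewrite -st; exact: (F_level _).2.
Qed.

End Fusion.

Fixpoint prefix_rev (c : nat -> bool) n : seq bool :=
  if n is m.+1 then c m :: prefix_rev c m else [::].

Lemma size_prefix_rev c n : size (prefix_rev c n) = n.
Proof. by elim: n => //= n ->. Qed.

Lemma prefix_rev_eq c c' n :
  prefix_rev c n = prefix_rev c' n <-> forall k, (k < n)%N -> c k = c' k.
Proof.
elim: n => [|n IH] //=; split=> [[cn /IH e] k|e].
  by rewrite ltnS leq_eqVlt => /predU1P[->|/e].
by rewrite e//; congr cons; apply/IH => k kn; exact/e/ltnW.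
Qed.

(** * A Cantor set of independent points *)

Section PerfectFamily.
Context {R : realType} {P : metricType R}.
Local Open Scope ring_scope.

Lemma continuous_cantor (x : cantor_space -> P) :
  (forall n c c', (forall k, (k < n)%N -> c k = c' k) ->
     mdist (x c) (x c') <= mesh n + mesh n) -> continuous x.
Proof.
move=> hx c; apply/metricType_numDomainType.cvgrPdist_lt => e e0.
have [n ne] := @mesh_small R (e / 2) (divr_gt0 e0 (ltr0Sn _ _)).
suff : \forall c' \near c, forall k, (k < n)%N -> c k = c' k.
  apply: filterS => c' /hx xx; apply: le_lt_trans xx _.
  by rewrite (splitr e) ltrD.
elim: n {ne} => [|n IH].
  apply: (@filterS _ _ (nbhs_filter c) setT) => [c' _ k //|].
  exact: filterT.
have cn : \forall c' \near c, c n = c' n.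
  have := @proj_continuous _ (fun=> bool) n c => /(_ [set c n] (discrete_set1 _)).
  by apply: filterS => c' /= ->.
apply: filterS2 IH cn => c' h cn k.
by rewrite ltnS leq_eqVlt => /predU1P[->|/h].
Qed.

(** The points [x c] are limits of points of [S]. They stay in [B] and are kept
    apart by the maps [h i], although [S] is arbitrary and the [h i] are only
    Borel: all the relevant memberships are read off a closed witness, which
    survives the passage to the limit. *)
Lemma perfect_family (S B : set P) (h : nat -> P -> P) :
  polish P -> ~ countable S -> S `<=` B -> <<s open >> B ->
  (forall i U, open U -> <<s open >> (h i @^-1` U)) ->
  exists x : cantor_space -> P, [/\ continuous x, forall c, B (x c) &
    forall i c c', c <> c' -> h i (x c) <> x c'].
Proof.
move=> polP Sunc SB bB bh.
have [p Sp] : S !=set0 by apply/set0P/eqP => S0; apply: Sunc; rewrite S0.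
have [d dd] := polish_dense_seq polP p.
pose U := dense_ball d.
pose D (i : option (option nat * (nat * nat))) : set P :=
  match i with
  | None => B
  | Some (None, m) => U m
  | Some (Some i, m) => h i @^-1` U m
  end.
have wD i : witnessed (D i).
  apply: witnessed_borel; case: i => [[[i|] m]|] //.
    by apply: bh; exact: open_dense_ball.
  by apply: sub_sigma_algebra; exact: open_dense_ball.
have [W [dec [k [cW tW WD]]]] := witnessed_family wD.
have [w1 w1P] := choice (name_exists dd).
have [w2 w2P] := choice tW.
have [A [AS Asub Aconst Asep]] :=
  fusion_scheme (fun y n => (w1 y n, w2 y n)) h Sunc
    (fun y z => @dense_ball_separates _ _ d y z dd).
(* [q (c, n)] is a point of the set at level [n] of the branch [c]. *)
have /choice[q qA] cn : exists y, A (prefix_rev cn.1 cn.2) y.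
  by case: (AS (prefix_rev cn.1 cn.2)).
have Amono c m n : (m <= n)%N -> A (prefix_rev c n) `<=` A (prefix_rev c m).
  elim: n => [|n IH]; first by rewrite leqn0 => /eqP->.
  rewrite leq_eqVlt => /predU1P[->//|/IH]; apply: subset_trans; exact: Asub.
have agree c m n y : (m <= n)%N -> A (prefix_rev c n) y ->
    w1 y m = w1 (q (c, m)) m /\ w2 y m = w2 (q (c, m)) m.
  move=> mn /(Amono _ _ _ mn) Ay.
  by have := Aconst _ _ _ Ay (qA (c, m)); rewrite size_prefix_rev => -[-> ->].
(* The diagonal sequences are the limits, along the branch [c], of the names
   and of the witnesses. *)
pose al1 c n := w1 (q (c, n)) n.
pose al2 c n := w2 (q (c, n)) n.
have near_q c n m : (n <= m)%N -> mdist (d (al1 c n)) (q (c, m)) <= mesh n.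
  rewrite /al1 => nm; have [<- _] := agree c n m _ nm (qA (c, m)).
  exact: w1P.
have /choice[x xP] (c : cantor_space) : exists z, name d (al1 c) z.
  apply: name_complete => // n m.
  apply: le_trans (metric_triangle _ (q (c, maxn n m)) _) _.
  by rewrite lerD//; [|rewrite metric_sym]; apply: near_q;
    rewrite ?leq_maxl ?leq_maxr.
have xW c : W (al2 c) (x c).
  apply: cW => n e e0.
  have [N Ne] := @mesh_small R (e / 2) (divr_gt0 e0 (ltr0Sn _ _)).
  exists (w2 (q (c, maxn n N))), (q (c, maxn n N)); split => //.
    move=> j jn; have [] := agree c j (maxn n N) _ _ (qA (c, _)) => //.
    by rewrite leq_max (ltnW jn).
  apply: le_lt_trans (metric_triangle _ (d (al1 c N)) _) _.
  rewrite (splitr e) ltrD//; last first.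
    by apply: le_lt_trans Ne; apply: near_q; exact: leq_maxr.
  by rewrite metric_sym; apply: le_lt_trans Ne; exact: xP.
have xD c i n : (k i <= n)%N -> A (prefix_rev c n) `<=` D i -> D i (x c).
  move=> kn AD; apply/(WD _ _ _ (xW c)).
  rewrite /al2; have := qA (c, n) => /=.
  have [_ <-] := agree c (k i) n _ kn (qA (c, n)).
  by move=> /AD /(WD _ _ _ (w2P _)).
have xnD c i n : (k i <= n)%N -> A (prefix_rev c n) `<=` ~` D i -> ~ D i (x c).
  move=> kn AD /(WD _ _ _ (xW c)).
  rewrite /al2; have := qA (c, n) => /=.
  have [_ <-] := agree c (k i) n _ kn (qA (c, n)).
  by move=> /AD nD /(WD _ _ _ (w2P _)).
exists x; split.
- apply: continuous_cantor => n c c' cc'.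
  have e : al1 c n = al1 c' n.
    apply: (agree c' n n _ _ _).1 => //.
    by rewrite -(prefix_rev_eq c c' n).2//; exact: (qA (c, n)).
  apply: le_trans (metric_triangle _ (d (al1 c n)) _) _.
  by rewrite lerD//; [rewrite metric_sym; exact: xP|rewrite e; exact: xP].
- move=> c; apply: (xD c None (k None)) => // y Ay; apply: SB.
  exact: (AS _).1 Ay.
- move=> i c c' cc' hx.
  have [n0 cn0] : exists n0, c n0 <> c' n0.
    apply: contrapT => h0; apply: cc'; apply/funext => n.
    by apply: contrapT => ?; apply: h0; exists n.
  pose n := maxn i n0.+1.
  have [|||m [mc mc']] := Asep (prefix_rev c n) (prefix_rev c' n) i.
  - by rewrite !size_prefix_rev.
  - by rewrite size_prefix_rev leq_maxl.
  - by move/prefix_rev_eq/(_ n0 (leq_maxr _ _)).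
  (* The entries that decide [U m] and its preimage may come after level
     [n], and are waited for further along the two branches. *)
  have Uhx : U m (h i (x c)).
    apply: (xD c (Some (Some i, m)) (maxn n (k (Some (Some i, m))))).
      exact: leq_maxr.
    by apply: subset_trans mc; apply: Amono; exact: leq_maxl.
  have := xnD c' (Some (None, m)) (maxn n (k (Some (None, m))))
    (leq_maxr _ _).
  rewrite /= -hx; apply => //.
  by apply: subset_trans mc'; apply: Amono; exact: leq_maxl.
Qed.

End PerfectFamily.

(** * Borel maps into standard Borel spaces *)

Section BorelMaps.
Context {R : realType}.

Lemma borel_map_standard (Y X : borelSpace) (P : metricType R)
    (p : X -> P) (f : Y -> X) : bijective p ->
  (forall B : set P, <<s open >> B <-> borel (p @^-1` B)) ->
  (forall U : set P, open U -> borel [set y | U (p (f y))]) -> borel_map f.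
Proof.
move=> [q pK qK] pB fU B bB.
have -> : B = p @^-1` (q @^-1` B) by apply/funext => x /=; rewrite pK.
have : <<s open >> (q @^-1` B).
  by apply/pB; rewrite (_ : _ @^-1` _ = B)//; apply/funext => x /=; rewrite pK.
pose M : set (set P) := [set C | borel [set y | C (p (f y))]].
suff : <<s open >> `<=` M by apply.
have sY := borel_sigma_algebra Y.
apply: smallest_sub => //; split.
- exact: (sa_const sY).
- by move=> C MC; rewrite setTD; exact: (sa_not sY).
- move=> C MC; rewrite /M /=.
  rewrite (_ : [set _ | _] = [set y | exists i, C i (p (f y))]).
    exact: (sa_exists sY).
  by apply/seteqP; split=> y [i]; exists i.
Qed.

Lemma borel_equalizer (Y X : borelSpace) (f g : Y -> X) :
  standard_borel R X -> borel_map f -> borel_map g -> borel [set y | f y = g y].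
Proof.
move=> [P [p [polP pbij pB]]] bf bg; have sY := borel_sigma_algebra Y.
have [y0|noY] := pselect (exists y : Y, True); last first.
  rewrite (_ : [set _ | _] = [set _ | True]); first exact: (sa_const sY).
  by apply/seteqP; split=> y // _; case: noY; exists y.
have [d dd] : exists d : nat -> P, dense_seq d.
  by case: y0 => y _; exact: polish_dense_seq polP (p (f y)).
rewrite (_ : [set _ | _] = [set y | forall m,
    dense_ball d m (p (f y)) -> dense_ball d m (p (g y))]); last first.
  apply/seteqP; split=> y /= => [->//|sep].
  apply: (bij_inj pbij); apply: contrapT => /(dense_ball_separates dd)[m [m1]].
  by apply; exact: sep.
have bball m : borel (p @^-1` dense_ball d m).
  by apply/pB; apply: sub_sigma_algebra; exact: open_dense_ball.
by apply: (sa_forall sY) => m; apply: (sa_impl sY);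
  [exact: bf (bball m)|exact: bg (bball m)].
Qed.

Local Open Scope ring_scope.

(** The set [E n k] is meant for the points whose code has [k] as its [n]-th
    entry. A point is decoded when it lies in exactly one [E n k] for each
    [n] and these [k] name a point of [X]; all other points are sent to
    [x0]. *)
Lemma borel_decoding (X Y : borelSpace) (E : nat -> nat -> set Y) :
  standard_borel R X -> X -> (forall n k, borel (E n k)) ->
  exists f : Y -> X, borel_map f /\
    forall x, exists s : nat -> nat -> bool,
      forall y, (forall n k, E n k y <-> s n k) -> f y = x.
Proof.
move=> [P [p [polP pbij pB]]] x0 bE; have sY := borel_sigma_algebra Y.
have [d dd] := polish_dense_seq polP (p x0).
have [q pK qK] := pbij.
pose digits y a := forall n k, E n k y <-> k = a n.
pose decodes y x := exists2 a, digits y a & name d a (p x).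
have decodes_unique y x x' : decodes y x -> decodes y x' -> x = x'.
  move=> [a ya ax] [a' ya' ax']; apply: (bij_inj pbij).
  apply: name_unique ax _; rewrite (_ : a = a')//.
  by apply/funext => n; apply/ya'; apply/ya.
pose f y :=
  if pselect (exists x, decodes y x) is left e then sval (cid e) else x0.
have fE y x : decodes y x -> f y = x.
  rewrite /f => yx; case: pselect => [e|[]]; last by exists x.
  by apply: decodes_unique yx; case: cid.
pose valid y := (forall n, exists k, forall j, E n j y <-> j = k) /\
  forall n m j k, E n j y -> E m k y -> mdist (d j) (d k) <= mesh n + mesh m.
have validE y : valid y <-> exists x, decodes y x.
  split=> [[/choice[a ya] close]|[x [a ya ax]]].
    have [|z az] := @name_complete R P d a polP.
      by move=> n m; apply: close; apply/ya.
    by exists (q z), a => //; rewrite qK.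
  split=> [n|n m j k /ya -> /ya ->]; first by exists (a n); exact: ya.
  apply: le_trans (metric_triangle _ (p x) _) _.
  by rewrite lerD//; rewrite metric_sym.
have bvalid : borel [set y | valid y].
  apply: (sa_and sY).
    apply: (sa_forall sY) => n; apply: (sa_exists sY) => k.
    apply: (sa_forall sY) => j; apply: (sa_and sY); apply: (sa_impl sY) => //;
    solve [exact: (sa_const sY)|exact: bE].
  do 4 (apply: (sa_forall sY) => ?).
  do 2 (apply: (sa_impl sY); first exact: bE).
  exact: (sa_const sY).
exists f; split.
  apply: (borel_map_standard pbij pB) => U oU.
  rewrite (_ : [set _ | _] = [set y |
    (valid y /\ exists n k, E n k y /\
       forall z, mdist (d k) z <= mesh n -> U z) \/ (~ valid y /\ U (p x0))]).
    apply: (sa_or sY); apply: (sa_and sY) => //.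
    - apply: (sa_exists sY) => n; apply: (sa_exists sY) => k.
      by apply: (sa_and sY); [exact: bE|exact: (sa_const sY)].
    - exact: (sa_not sY).
    - exact: (sa_const sY).
  apply/funext => y /=; apply/propext.
  have [vy|nvy] := pselect (valid y); last first.
    rewrite (_ : f y = x0).
      by split=> [Ux|[[]|[]]//]; right.
    by rewrite /f; case: pselect => // dy; case: nvy; apply/validE.
  have [x yx] := (validE y).1 vy; rewrite (fE _ _ yx).
  have [a ya ax] := yx; rewrite (name_open ax oU).
  split=> [[n nU]|[[_ [n [k [ynk kU]]]]|[//]]]; last first.
    by exists n; rewrite -((ya n k).1 ynk).
  by left; split=> //; exists n, (a n); split=> //; exact: (ya n _).2.
move=> x; have [a ax] := name_exists dd (p x).
exists (fun n k => k == a n) => y ya; apply: fE; exists a => // n k.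
by split=> [/ya/eqP|->]//; apply/ya.
Qed.

End BorelMaps.

(** * Partial Borel transversals of the free part *)

Section Transversal.
Context {R : realType} {G : groupType}.

Lemma countable_enum (T : Type) : countable [set: T] -> T ->
  exists e : nat -> T, forall t, exists n, e n = t.
Proof.
move=> /pfcard_geP[T0 t|[f] _]; first by have : [set: T] t by []; rewrite T0.
by exists f => t; have [n _ <-] := @surj _ _ _ _ f t I; exists n.
Qed.

(** The sets [E n k] are independent on [T]: they are the coordinates of the
    Cantor space, indexed by pairs of integers. Applied to all group
    elements, [perfect_family] makes two points of [T] in the same orbit
    equal, and freeness then forces the group element to be 1. *)
Lemma borel_transversal (Y : borelSpace) (a : borelAction G Y) (Y0 : set Y) :
  countable [set: G] -> standard_borel R Y ->
  ~ countable Y0 -> free_on a Y0 ->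
  exists (T : set Y) (E : nat -> nat -> set Y), [/\ borel T,
    forall n k, borel (E n k),
    forall g y, T y -> T (a g y) -> g = 1%g &
    forall s : nat -> nat -> bool,
      exists y, T y /\ forall n k, E n k y <-> s n k].
Proof.
move=> cG stY Y0unc Y0free; have sY := borel_sigma_algebra Y.
have [e eS] := countable_enum cG 1%g.
have [P [f [polP fbij fB]]] := stY.
have [f' fK f'K] := fbij.
pose Fr := [set y | forall g, g <> 1%g -> a g y <> y].
have bFr : borel Fr.
  rewrite (_ : Fr = [set y | forall i, e i <> 1%g -> ~ (a (e i) y = y)]).
    apply: (sa_forall sY) => i; apply: (sa_impl sY); first exact: (sa_const sY).
    apply: (sa_not sY); apply: (borel_equalizer stY); first exact: act_borel.
    by move=> B.
  apply/seteqP; split=> y /= h; first by move=> i; exact: h.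
  by move=> g; have [i <-] := eS g; exact: h.
have sub_f (B : set Y) : f @^-1` (f' @^-1` B) = B.
  by apply/funext => y /=; rewrite fK.
have bf' (B : set Y) : borel B -> <<s open >> (f' @^-1` B).
  by move=> bB; apply/fB; rewrite sub_f.
pose h i := f \o a (e i) \o f'.
have [||||x [cx xFr xsep]] :=
    @perfect_family R P (f' @^-1` Y0) (f' @^-1` Fr) h polP.
- move=> /countable_injP[k kinj]; apply: Y0unc; apply/countable_injP.
  exists (k \o f) => y z; rewrite !inE => Y0y Y0z /kinj yz.
  by apply: (bij_inj fbij); apply: yz; rewrite inE /= fK.
- by move=> z Y0z g; exact: Y0free.
- exact: bf'.
- move=> i U oU; rewrite /h -[_ @^-1` U]/(f' @^-1` (a (e i) @^-1` (f @^-1` U))).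
  apply: bf'; apply: act_borel; apply/fB; exact: sub_sigma_algebra.
have xinj c c' : x c = x c' -> c = c'.
  have [i ei] := eS 1%g => xx; apply: contrapT => /(xsep i); apply.
  by rewrite /h /= ei act1 f'K.
have bclosed (C : set P) : closed C -> borel (f @^-1` C).
  move=> cC; rewrite -[C]setCK; apply/fB.
  have := smallest_sigma_algebra setT (@open P) => -[_ + _].
  move=> /(_ (~` C)); rewrite setTD; apply; apply: sub_sigma_algebra.
  by rewrite openC.
(* A closed subset of the Cantor space has a compact, hence closed, image. *)
have bimage (C : set cantor_space) : closed C -> borel (f @^-1` (x @` C)).
  move=> cC; apply: bclosed; apply: compact_closed; first exact: metric_hausdorff.
  apply: continuous_compact; first exact: continuous_subspaceT.
  exact: subclosed_compact cC cantor_space_compact _.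
exists (f @^-1` range x), (fun n k =>
  f @^-1` (x @` [set c : cantor_space | c (pickle (n, k))])).
split.
- by apply: bimage; exact: closedT.
- move=> n k; apply: bimage.
  have -> : [set c : cantor_space | c (pickle (n, k))] =
     (proj (pickle (n, k))) @^-1` [set true] by apply/seteqP; split.
  apply: closed_comp; last exact: discrete_closed.
  by move=> c _; exact: proj_continuous.
- move=> g y [c _ xc] [c' _ xc'].
  have [i ei] := eS g.
  have cc' : c = c'.
    by apply: contrapT => /(xsep i); apply; rewrite xc xc' /h /= fK ei.
  apply: contrapT => g1; apply: (xFr c g g1).
  by rewrite xc fK; apply: (bij_inj fbij); rewrite -xc' -xc cc'.
- move=> s.
  pose c : cantor_space :=
    fun m => if unpickle m is Some nk then s nk.1 nk.2 else false.
  exists (f' (x c)); split; first by rewrite /= f'K; exists c.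
  move=> n k; rewrite /= f'K; split=> [[c' c'nk /xinj ec]|snk].
    by move: c'nk; rewrite ec /c pickleK.
  by exists c => //; rewrite /c pickleK.
Qed.

(** Two different [g] with [g y] in [T] would give two points of [T] in one orbit,
    so the value of [F] at [y] does not depend on the choice of [g], and the
    preimages under [F] are countable unions of translates of Borel sets. *)
Lemma extend_from_transversal (Y X : borelSpace)
    (a : borelAction G Y) (b : borelAction G X) (T : set Y) (f : Y -> X) (x0 : X) :
  countable [set: G] -> borel T -> borel_map f ->
  (forall g y, T y -> T (a g y) -> g = 1%g) ->
  exists F : Y -> X, [/\ borel_map F,
    forall g y, T (a g y) -> F y = b g^-1%g (f (a g y)) &
    forall y, ~ (exists g, T (a g y)) -> F y = x0].
Proof.
move=> cG bT bf Tfree; have sY := borel_sigma_algebra Y.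
have [e eS] := countable_enum cG 1%g.
have Tunique g k y : T (a g y) -> T (a k y) -> g = k.
  move=> Tg Tk; have : T (a (k * g^-1)%g (a g y)) by rewrite -actM mulgVK.
  by move=> /(Tfree _ _ Tg) kg1; rewrite -[k](mulgVK g) kg1 mul1g.
pose F y := if pselect (exists g, T (a g y)) is left h
  then b (sval (cid h))^-1%g (f (a (sval (cid h)) y)) else x0.
have FT g y : T (a g y) -> F y = b g^-1%g (f (a g y)).
  move=> Tg; rewrite /F; case: pselect => [h|[]]; last by exists g.
  by case: cid => k /= Tk; rewrite (Tunique _ _ _ Tg Tk).
have Fout y : ~ (exists g, T (a g y)) -> F y = x0 by rewrite /F; case: pselect.
exists F; split=> // B bB.
rewrite (_ : F @^-1` B = [set y |
    (exists i, T (a (e i) y) /\ B (b (e i)^-1%g (f (a (e i) y)))) \/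
    (~ (exists i, T (a (e i) y)) /\ B x0)]).
  have bTg i : borel [set y | T (a (e i) y)] by exact: (act_borel a (e i) bT).
  apply: (sa_or sY); last first.
    apply: (sa_and sY); last exact: (sa_const sY).
    by apply: (sa_not sY); apply: (sa_exists sY).
  apply: (sa_exists sY) => i; apply: (sa_and sY) => //.
  exact: (act_borel a (e i) (bf _ (act_borel b _ bB))).
apply/funext => y /=; apply/propext.
have [[g Tg]|nT] := pselect (exists g, T (a g y)).
  have [i ei] := eS g; rewrite (FT g)//; split=> [BF|].
    by left; exists i; rewrite ei.
  move=> [[j [Tj]]|[[]]]; last by exists i; rewrite ei.
  by rewrite (Tunique _ _ _ Tj Tg).
rewrite Fout//; split=> [Bx|[[i [Ti _]]|[]//]].
  by right; split=> // -[i Ti]; apply: nT; exists (e i).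
by case: nT; exists (e i).
Qed.

End Transversal.

(** Both claims come from one map [F] on [Y], with value [x0] off the saturation
    of [T]. It is equivariant on the saturation for every choice of [x0]. As the
    complement is invariant too, it is equivariant on [Y] when [x0] is a fixed
    point. *)
Theorem proposition1p5 (R : realType) (G : groupType) (Y : borelSpace)
    (a : borelAction G Y) (Y0 : set Y) :
  countable [set: G] ->
  standard_borel R Y ->
  ~ countable Y0 ->
  invariant_set a Y0 ->
  free_on a Y0 ->
  forall (X : borelSpace) (b : borelAction G X),
    standard_borel R X ->
    (exists (Z : set Y) (invZ : invariant_set a Z),
        borel Z /\ borel_factors_onto (sub_action invZ) b)
    /\ ((exists x0 : X, forall g : G, b g x0 = x0) -> borel_factors_onto a b).
Proof.
move=> cG stY Y0unc invY0 freeY0 X b stX; have sY := borel_sigma_algebra Y.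
have [T [E [bT bE Tfree TE]]] := borel_transversal cG stY Y0unc freeY0.
have [e eS] := countable_enum cG 1%g.
have factor (x0 : X) : exists F : Y -> X, [/\ borel_map F,
    forall g y, (exists k, T (a k y)) -> F (a g y) = b g (F y),
    forall y, ~ (exists k, T (a k y)) -> F y = x0 &
    forall x, exists2 y, T y & F y = x].
  have [f [bf fsurj]] := borel_decoding stX x0 bE.
  have [F [bF FT Fout]] := extend_from_transversal b x0 cG bT bf Tfree.
  exists F; split=> // [g y [k Tk]|x].
    have kg : a (k * g^-1)%g (a g y) = a k y by rewrite -actM mulgVK.
    by rewrite (FT k y)// (FT (k * g^-1)%g) kg// invgM invgK actM.
  have [s sx] := fsurj x; have [y [Ty Ey]] := TE s.
  by exists y => //; rewrite (FT 1%g) ?act1// invg1 act1 sx.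
split.
  (* The second condition empties [Z] when [X] is empty, as there is then no
     map from a nonempty set to [X]. *)
  pose Z := [set y | (exists k, T (a k y)) /\ (exists x : X, True)].
  have invZ : invariant_set a Z.
    move=> g y [[k Tk] ?]; split=> //; exists (k * g^-1)%g.
    by rewrite -actM mulgVK.
  exists Z, invZ; split.
    apply: (sa_and sY); last exact: (sa_const sY).
    rewrite (_ : [set _ | _] = [set y | exists i, T (a (e i) y)]).
      by apply: (sa_exists sY) => i; exact: (act_borel a (e i) bT).
    apply/seteqP; split=> y [k Tk]; last by exists (e k).
    by have [i ei] := eS k; exists i; rewrite ei.
  have [[x0 _]|X0] := pselect (exists x : X, True); last first.
    exists (fun z : subspace_borel Z => False_rect X (X0 (set_valP z).2)); split.
    - move=> B _; exists set0; first exact: (sa_const sY False).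
      by apply/seteqP; split=> z //; case: (X0 (set_valP z).2).
    - by move=> g z; case: (X0 (set_valP z).2).
    - by move=> x; case: X0; exists x.
  have [F [bF Fequiv _ Fsurj]] := factor x0.
  exists (F \o set_val); split.
  - by move=> B bB; exists (F @^-1` B); [exact: bF|].
  - by move=> g z; exact: (Fequiv g _ (set_valP z).1).
  - move=> x; have [y Ty <-] := Fsurj x.
    have Zy : Z y by split; [exists 1%g; rewrite act1|exists x0].
    by exists (SigSub (mem_set Zy)).
move=> [x0 x0fix]; have [F [bF Fequiv Fout Fsurj]] := factor x0.
exists F; split=> // [g y|x]; last by have [y _ <-] := Fsurj x; exists y.
have [yT|nT] := pselect (exists k, T (a k y)); first exact: Fequiv.
rewrite !Fout// => -[k Tk]; apply: nT; exists (k * g)%g.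
by rewrite actM.
Qed.
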